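(* A separation system $\vec S$ can be implemented by bipartitions of sets if and only if it is fastidious.
   Context: A separation system is a poset $\vec S$ together with an order-reversing involution $\vec s\mapsto\vec s^{\,*}$. An element $\vec s$ is small if $\vec s\le\vec s^{\,*}$. $\vec S$ is fastidious if $\vec s\le\vec t$ for every small $\vec s\in\vec S$ and every $\vec t\in\vec S$. A homomorphism of separation systems is an order-preserving map commuting with the involutions; an isomorphism is a bijective homomorphism whose inverse is also a homomorphism. For a set $V$, $\mathcal{SB}(V)$ is the separation system of all pairs $(A,B)$ of subsets of $V$ with $A\cup B=V$ and $A\cap B=\emptyset$ (empty sides allowed), with involution $(A,B)^*=(B,A)$ and order $(A,B)\le(C,D)$ iff $A\subseteq C$ and $D\subseteq B$. A sub-system is a subset closed under the involution, with the induced order. $\vec S$ can be implemented by bipartitions if there are a set $V$ and a sub-system of $\mathcal{SB}(V)$ isomorphic to $\vec S$. *)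

(* Defs.v *)
From HB Require Import structures.
From mathcomp Require Import all_boot all_order.
From mathcomp Require Import boolp classical_sets.
Set Implicit Arguments.
Unset Strict Implicit.
Unset Printing Implicit Defensive.
Import Order.TTheory.
Local Open Scope order_scope.
Local Open Scope classical_set_scope.

(* Every poset is covered: by the classical axioms of boolp, any type is a
   choiceType and any Prop-valued order has a boolean counterpart. *)
HB.mixin Record POrder_isSepSystem d S of Order.POrder d S := {
  sepinv : S -> S;
  sepinvK : involutive sepinv;
  sepinv_le : forall s t : S, s <= t -> sepinv t <= sepinv s
}.

#[short(type="sepSystemType")]
HB.structure Definition SepSystem d :=
  { S of Order.POrder d S & POrder_isSepSystem d S }.

Definition small d (S : sepSystemType d) (s : S) : Prop := s <= sepinv s.

Definition fastidious d (S : sepSystemType d) : Prop :=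
  forall s : S, small s -> forall t : S, s <= t.

Definition sep_hom d (S : sepSystemType d) d' (S' : sepSystemType d')
    (f : S -> S') : Prop :=
  (forall s t : S, s <= t -> f s <= f t) /\
  (forall s : S, f (sepinv s) = sepinv (f s)).

Definition sep_isom d (S : sepSystemType d) d' (S' : sepSystemType d')
    (f : S -> S') : Prop :=
  sep_hom f /\
  exists g : S' -> S, [/\ cancel f g, cancel g f & sep_hom g].

Definition sep_isomorphic d (S : sepSystemType d) d' (S' : sepSystemType d')
  : Prop := exists f : S -> S', sep_isom f.

Record subsystem d (S : sepSystemType d) := Subsystem {
  subsystem_set : set S;
  subsystem_closed :
    forall s : S, subsystem_set s -> subsystem_set (sepinv s)
}.

Section SubsystemType.
Variables (d : Order.disp_t) (S : sepSystemType d) (U : subsystem S).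

Record subsystem_type : Type := SubsystemElt {
  subsystem_val : S;
  subsystem_valP : subsystem_val \in subsystem_set U
}.

HB.instance Definition _ := [isSub for subsystem_val].
HB.instance Definition _ := [Choice of subsystem_type by <:].
(* The order induced by S on the subset. *)
HB.instance Definition _ :=
  [SubChoice_isSubPOrder of subsystem_type by <: with d].

Lemma subsystem_inv_subproof (s : subsystem_type) :
  sepinv (val s) \in subsystem_set U.
Proof.
by rewrite inE; apply: subsystem_closed; rewrite -in_setE; exact: (valP s).
Qed.

Definition subsystem_inv (s : subsystem_type) : subsystem_type :=
  Sub (sepinv (val s)) (subsystem_inv_subproof s).

Lemma subsystem_invK : involutive subsystem_inv.
Proof. by move=> s; apply: val_inj; rewrite /= sepinvK. Qed.

Lemma subsystem_inv_le (s t : subsystem_type) :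
  s <= t -> subsystem_inv t <= subsystem_inv s.
Proof. by rewrite -!Order.le_val /=; exact: sepinv_le. Qed.

HB.instance Definition _ :=
  POrder_isSepSystem.Build d subsystem_type subsystem_invK subsystem_inv_le.

End SubsystemType.

Coercion subsystem_type : subsystem >-> Sortclass.

Fact SB_display : Order.disp_t. Proof. exact: (Order.Disp tt tt). Qed.

Section Bipartitions.
Variable V : Type.

Record SB : Type := Bipartition {
  lside : set V;
  rside : set V;
  bipartition_setU : lside `|` rside = [set: V];
  bipartition_setI : lside `&` rside = set0
}.

Lemma SB_ext (x y : SB) : lside x = lside y -> rside x = rside y -> x = y.
Proof.
case: x y => [A B hU hI] [C D hU' hI'] /= AC BD; subst C D.
by rewrite (Prop_irrelevance hU hU') (Prop_irrelevance hI hI').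
Qed.

HB.instance Definition _ := gen_eqMixin SB.
HB.instance Definition _ := gen_choiceMixin SB.

Definition SB_le (x y : SB) : bool :=
  `[< lside x `<=` lside y /\ rside y `<=` rside x >].

Lemma SB_le_refl : reflexive SB_le.
Proof. by move=> x; apply/asboolP; split. Qed.

Lemma SB_le_anti : antisymmetric SB_le.
Proof.
move=> x y /andP[/asboolP[xy1 yx2] /asboolP[yx1 xy2]].
by apply: SB_ext; apply/seteqP.
Qed.

Lemma SB_le_trans : transitive SB_le.
Proof.
move=> y x z /asboolP[xy1 yx2] /asboolP[yz1 zy2]; apply/asboolP.
by split; [exact: subset_trans yz1|exact: subset_trans yx2].
Qed.

HB.instance Definition _ :=
  Order.Le_isPOrder.Build SB_display SB SB_le_refl SB_le_anti SB_le_trans.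

Definition SB_inv (x : SB) : SB :=
  Bipartition (etrans (setUC _ _) (bipartition_setU x))
              (etrans (setIC _ _) (bipartition_setI x)).

Lemma SB_invK : involutive SB_inv.
Proof. by move=> x; apply: SB_ext. Qed.

Lemma SB_inv_le (x y : SB) : x <= y -> SB_inv y <= SB_inv x.
Proof. by move=> /asboolP[xy1 yx2]; apply/asboolP; split. Qed.

HB.instance Definition _ :=
  POrder_isSepSystem.Build SB_display SB SB_invK SB_inv_le.

End Bipartitions.

Definition bipartition_implementable d (S : sepSystemType d) : Prop :=
  exists (V : Type) (U : subsystem (SB V)), sep_isomorphic U S.

(* Main.v *)
(** The only small bipartition is [(set0, setT)], which is least; this passes to
    sub-systems and isomorphic copies.  Conversely, represent [s] by the
    bipartition of the set of consistent orientations of [S] into those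
    containing [s] and those containing the inverse of [s].  If [s] is not below
    [t], fastidiousness makes the set consisting of [s] and the inverse of [t]
    consistent, and by Zorn's lemma it extends to an orientation, so the
    bipartition of [s] is not below that of [t].  If some [s] equals its inverse
    there is no orientation at all, but then fastidiousness forces [S] to be a
    singleton. *)
Require Import Defs.
From mathcomp Require Import all_boot all_order.
From mathcomp Require Import boolp classical_sets.
Set Implicit Arguments.
Unset Strict Implicit.
Unset Printing Implicit Defensive.
Import Order.TTheory.
Local Open Scope order_scope.
Local Open Scope classical_set_scope.

Section SeparationSystems.
Variables (d : Order.disp_t) (S : sepSystemType d).
Implicit Types (s t x y : S) (A O : set S).

Lemma le_sepinv s t : (sepinv t <= sepinv s) = (s <= t).
Proof.
by apply/idP/idP => /sepinv_le; rewrite ?sepinvK.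
Qed.

Lemma le_sepinvr s t : (s <= sepinv t) = (t <= sepinv s).
Proof. by rewrite -le_sepinv sepinvK. Qed.

(** The case [x = y] is included, so a consistent set contains no small element. *)
Definition consistent A := forall x y, A x -> A y -> ~ x <= sepinv y.

(** Orientations are closed upwards, so that a larger element lies in more of them, matching the
    order on bipartitions. *)
Definition orientation O :=
  [/\ forall x, O x \/ O (sepinv x),
      forall x, ~ (O x /\ O (sepinv x)) &
      forall x y, x <= y -> O x -> O y].

Lemma maximal_consistent A : consistent A ->
  exists O, [/\ A `<=` O, consistent O &
    forall x, consistent (x |` O) -> O x].
Proof.
move=> cA.
(* Ranging over [B] with [A `|` B] consistent, rather than over the supersets
   of [A], makes the empty chain harmless. *)
have [F FP Ftot|B [cAB Bmax]] := @Zorn_bigcup S (fun B => consistent (A `|` B)).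
  move=> x y [Ax|[X FX Xx]] [Ay|[Y FY Yy]].
  - exact: cA.
  - by apply: (FP _ FY x y); [left|right].
  - by apply: (FP _ FX x y); [right|left].
  - have [XY|YX] := Ftot _ _ FX FY.
    + by apply: (FP _ FY x y); right => //; exact: XY.
    + by apply: (FP _ FX x y); right => //; exact: YX.
exists (A `|` B); split => // x cx; apply: contrapT => ABx.
apply: (Bmax (x |` B)); last by rewrite setUCA.
split; first by move=> y; right.
by move=> /(_ x (or_introl erefl)) Bx; apply: ABx; right.
Qed.

Hypothesis fS : fastidious S.

(** Only the pair [x], [x] needs fastidiousness: [x] is then small, hence below the inverse of any
    element of [O]. *)
Lemma inconsistent_setU1 O x : O !=set0 -> consistent O ->
  ~ consistent (x |` O) -> exists2 y, O y & x <= sepinv y.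
Proof.
move=> [z Oz] cO ncx; apply: contrapT => nex; apply: ncx.
have nx y : O y -> ~ x <= sepinv y by move=> Oy xy; apply: nex; exists y.
move=> u v [->|Ou] [->|Ov].
- by move=> xx; apply: (nx z Oz); exact: fS.
- exact: nx.
- by rewrite le_sepinvr; exact: nx.
- exact: cO.
Qed.

Lemma orientation_extension A : A !=set0 -> consistent A ->
  exists2 O, A `<=` O & orientation O.
Proof.
move=> [a Aa] /maximal_consistent[O [AO cO Omax]].
have O0 : O !=set0 by exists a; exact: AO.
have notO x : ~ O x -> exists2 y, O y & x <= sepinv y.
  by move=> nOx; apply: inconsistent_setU1 => // /Omax.
have total x : O x \/ O (sepinv x).
  (* If [x] and its inverse are both excluded, by [y] and [z] in [O], then [z <= x <= sepinv y]
     contradicts consistency. *)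
  have [|/notO[y Oy xy]] := EM (O x); first by left.
  have [|/notO[z Oz]] := EM (O (sepinv x)); first by right.
  by rewrite le_sepinv => zx; case: (cO z y Oz Oy); exact: le_trans xy.
have antipodal x : ~ (O x /\ O (sepinv x)).
  by move=> [Ox Ox']; apply: (cO _ _ Ox Ox'); rewrite sepinvK.
exists O => //; split => // x y xy Ox.
have [//|Oy'] := total y.
by case: (cO x _ Ox Oy'); rewrite sepinvK.
Qed.

Lemma orientation_separates s t : ~ s <= t ->
  exists O, [/\ orientation O, O s & ~ O t].
Proof.
move=> nst.
have [||O AO oO] := @orientation_extension [set s; sepinv t].
- by exists s; left.
(* Mixed pairs give [s <= t] directly; the other two make [s] or [sepinv t] small, hence least. *)
- move=> x y [->|->] [->|->]; rewrite ?sepinvK ?le_sepinv //.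
  + by move=> ss; apply: nst; exact: fS.
  + move=> tt; apply: nst; rewrite -le_sepinv; apply: fS.
    by rewrite /small sepinvK.
exists O; split => //; first by apply: AO; left.
case: oO => _ antipodal _ Ot; apply: (antipodal t); split => //.
by apply: AO; right.
Qed.

End SeparationSystems.

(** This reduces implementability to an order embedding that commutes with the involutions;
    antisymmetry makes it injective. *)
Lemma sep_isomorphic_range d (S : sepSystemType d) d' (S' : sepSystemType d')
    (h : S -> S') :
  (forall s t, (h s <= h t) = (s <= t)) ->
  (forall s, h (sepinv s) = sepinv (h s)) ->
  exists U : subsystem S', sep_isomorphic U S.
Proof.
move=> h_le h_inv.
have closed x : range h x -> range h (sepinv x).
  by move=> [s _ <-]; exists (sepinv s).
pose U := Subsystem closed.
have hU s : h s \in subsystem_set U by rewrite inE; exists s.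
pose g s : U := SubsystemElt (hU s).
have /choice[f fE] (u : U) : exists s, h s = val u.
  by have := valP u; rewrite inE => -[s _ <-]; exists s.
have h_inj s t : h s = h t -> s = t.
  by move=> hst; apply: le_anti; rewrite -!h_le hst lexx.
exists U, f; split; [split|].
- by move=> u v; rewrite -Order.le_val -!fE h_le.
- by move=> u; apply: h_inj; rewrite fE h_inv fE.
- exists g; split; [|by move=> s; apply: h_inj; rewrite fE|split].
  + by move=> u; apply: val_inj; rewrite /= fE.
  + by move=> s t; rewrite -Order.le_val /= h_le.
  + by move=> s; apply: val_inj; rewrite /= h_inv.
Qed.

Lemma fastidious_SB (V : Type) : fastidious (SB V).
Proof.
move=> x /asboolP[/= xlr _] y.
have xl v : ~ lside x v.
  move=> xv; have : (lside x `&` rside x) v by split => //; exact: xlr.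
  by rewrite bipartition_setI.
apply/asboolP; split => v; first by move=> /xl.
move=> _; have : (lside x `|` rside x) v by rewrite bipartition_setU.
by case=> // /xl.
Qed.

Lemma fastidious_subsystem d (S : sepSystemType d) (U : subsystem S) :
  fastidious S -> fastidious U.
Proof.
by move=> fS s; rewrite /small -Order.le_val => ss t; rewrite -Order.le_val fS.
Qed.

Lemma fastidious_sep_isomorphic d (S : sepSystemType d) d'
    (S' : sepSystemType d') :
  sep_isomorphic S S' -> fastidious S -> fastidious S'.
Proof.
move=> [f [[f_le _] [g [_ gK [g_le g_inv]]]]] fS s ss t.
rewrite -(gK s) -(gK t); apply/f_le/fS.
by rewrite /small -g_inv; exact: g_le.
Qed.

Section OrientationBipartition.
Variables (d : Order.disp_t) (S : sepSystemType d).
Let V := {O : set S | orientation O}.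

Definition orientation_side (s : S) : set V := [set O | sval O s].

Lemma orientation_side_setU s :
  orientation_side s `|` orientation_side (sepinv s) = [set: V].
Proof. by apply/seteqP; split => // -[O [total ? ?]] _; exact: total. Qed.

Lemma orientation_side_setI s :
  orientation_side s `&` orientation_side (sepinv s) = set0.
Proof. by apply/seteqP; split => // -[O [? antipodal ?]] /antipodal. Qed.

Definition orientation_bipartition (s : S) : SB V :=
  Bipartition (orientation_side_setU s) (orientation_side_setI s).

Lemma orientation_bipartition_inv s :
  orientation_bipartition (sepinv s) = sepinv (orientation_bipartition s).
Proof. by apply: SB_ext; rewrite //= sepinvK. Qed.

(** An empty [V] needs no separate case: a failure of [s <= t] itself produces an orientation. *)
Lemma orientation_bipartition_le : fastidious S -> forall s t,
  (orientation_bipartition s <= orientation_bipartition t) = (s <= t).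
Proof.
move=> fS s t; apply/idP/idP => [/asboolP[/= st _]|st].
  apply: contrapT => /(orientation_separates fS)[O [oO Os]]; apply.
  exact: (st (exist _ O oO)).
have side_le (x y : S) : x <= y -> orientation_side x `<=` orientation_side y.
  by move=> xy [O [? ? up]]; exact: up.
(* The right side of [s] is the left side of [sepinv s], so one inclusion serves for both sides. *)
by apply/asboolP; split; apply: side_le; rewrite ?le_sepinv.
Qed.

End OrientationBipartition.

Theorem theorem3p13 (d : Order.disp_t) (S : sepSystemType d) :
  bipartition_implementable S <-> fastidious S.
Proof.
split=> [[V [U /fastidious_sep_isomorphic]]|fS].
  by apply; apply: fastidious_subsystem; exact: fastidious_SB.
exists {O : set S | orientation O}.
apply: (sep_isomorphic_range (h := @orientation_bipartition d S)).
- exact: orientation_bipartition_le.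
- exact: orientation_bipartition_inv.
Qed.
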